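(* Let $H=H(\mathbf{g},\mathbf{\chi})=R\#\mathbf{k}G$ be the bosonization of a finite-dimensional Nichols algebra $R=\mathfrak{B}(V)$ of diagonal type over a finite abelian group $G$ (as defined in the context), let $\rho$ be its Nakayama automorphism with respect to a nonzero right integral of $H^*$, let $\alpha\in H^*$ be its modular element, let $L_1=\langle q_{11},\ldots,q_{nn},\alpha(G)\rangle\subseteq\mathbf{k}^*$ and $L_2=\alpha(G)\subseteq L_1$, and for $\omega\in L_1$ let $H_\omega=\{h\in H:\rho(h)=\omega h\}$, so that $H=\bigoplus_{\omega\in L_1}H_\omega$ is an $L_1$-grading of the algebra $H$. The following are equivalent: (1) the $L_1$-grading $H=\bigoplus_{\omega\in L_1}H_\omega$ is strongly graded; (2) $L_1=L_2$; (3) each $H_\omega$ ($\omega\in L_1$) contains an element of $G$; (4) $H$ is a crossed product $H_1\ltimes\mathbf{k}L_1$.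
   Context: Setting: $\mathbf{k}$ is a field, $G$ is a finite abelian group, $g_1,\ldots,g_n\in G$, $\chi_1,\ldots,\chi_n\in\hat G$ are characters $G\to\mathbf{k}^*$, and $q_{ij}=\chi_j(g_i)$. $V$ is the vector space with basis $x_1,\ldots,x_n$, with braiding $c(x_i\otimes x_j)=q_{ij}x_j\otimes x_i$. $T_c(V)$ is the tensor algebra of $V$ with the unique braided Hopf algebra structure whose braiding extends $c$ and in which the $x_i$ are primitive. The Nichols algebra $R=\mathfrak{B}(V)$ is the quotient of $T_c(V)$ by its largest homogeneous ideal generated in degrees $\ge 2$ which is also a coideal; equivalently, $R$ is the graded braided Hopf algebra quotient of $T_c(V)$ with $R^0=\mathbf{k}$, $R^1=V$, in which every primitive element lies in $V$. It is assumed that $R$ is finite-dimensional. The bosonization $H=R\#\mathbf{k}G$ is the Hopf algebra generated by $R$ and $G$, with $H=R\otimes\mathbf{k}G$ as a vector space, $gx_i=\chi_i(g)x_ig$, $\Delta(g)=g\otimes g$ for $g\in G$, $\Delta(x_i)=g_i\otimes x_i+x_i\otimes 1$, counit $\varepsilon(g)=1$, $\varepsilon(x_i)=0$, and antipode $S(g)=g^{-1}$, $S(x_i)=-g_i^{-1}x_i$. Nakayama automorphism: for a finite dimensional Hopf algebra $H$, a nonzero right integral $\varphi\in H^*$ (i.e. $\varphi * f=f(1)\varphi$ for all $f\in H^*$) is a Frobenius homomorphism, and $\rho$ is the algebra automorphism determined by $\varphi(ax)=\varphi(\rho(x)a)$ for all $a,x\in H$. It does not depend on the choice of $\varphi$,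 and it satisfies $\rho(h)=\alpha(S(h_{(1)}))S^2(h_{(2)})$. Modular element: if $t\in H$ is a nonzero right integral ($th=\varepsilon(h)t$ for all $h$), then $\alpha\colon H\to\mathbf{k}$ is the algebra map given by $ht=\alpha(h)t$. In the present case one can take $t=t_0\sum_{g\in G}g$, where $t_0\in R$ is a nonzero homogeneous element of greatest degree; then $\alpha(x_i)=0$, and $\alpha|_G$ is determined by $gt_0=\alpha(g)t_0g$. Also $\rho(g)=\alpha(g^{-1})g$ and $\rho(x_i)=\alpha(g_i^{-1})q_{ii}^{-1}x_i$. A grading $A=\bigoplus_{g\in L}A_g$ of an algebra by a group $L$ is strongly graded if $A_gA_h=A_{gh}$ for all $g,h\in L$. ''$H$ is a crossed product $H_1\ltimes\mathbf{k}L_1$'' is understood with respect to the given $L_1$-grading: it means that every component $H_\omega$, $\omega\in L_1$, contains an invertible element of $H$. Here $H_1$ is the component of $\omega=1$. *)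

(* Defs.v *)
From HB Require Import structures.
From mathcomp Require Import all_boot all_fingroup all_algebra all_field.
From mathcomp Require Import finmap.
From mathcomp Require Import monalg.

Set Implicit Arguments.
Unset Strict Implicit.
Unset Printing Implicit Defensive.

Import GRing.Theory.
Local Open Scope ring_scope.

(* Elements of U (x) V are encoded by their coordinates in the basis          *)
(* (e_i (x) f_j), where e and f are the chosen bases of U and V.              *)
Section Tensor.
Variable k : fieldType.

Definition tensor (U V : vectType k) : vectType k :=
  'M[k]_(\dim {: U}, \dim {: V}).

Definition tens (U V : vectType k) (u : U) (v : V) : tensor U V :=
  \matrix_(i, j) (coord (vbasis {: U}) i u * coord (vbasis {: V}) j v).

(* The linear map sending u (x) v to b u v, for b bilinear: if Delta is a     *)
(* comultiplication, tlift b (Delta h) is b(h_(1), h_(2)) in Sweedler form.   *)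
Definition tlift (U V : vectType k) (W : lmodType k) (b : U -> V -> W)
    (A : tensor U V) : W :=
  \sum_i \sum_j A i j *: b (vbasis {: U})`_i (vbasis {: V})`_j.

Lemma tlift_tens (U V : vectType k) (W : lmodType k) (b : U -> V -> W) :
    (forall v, linear (b^~ v)) -> (forall u, linear (b u)) ->
  forall u v, tlift b (tens u v) = b u v.
Proof.
move=> bl br u v.
pose br_ u0 : {linear V -> W} := HB.pack (b u0)
  (GRing.isLinear.Build k V W *:%R (b u0) (br u0)).
pose bl_ v0 : {linear U -> W} := HB.pack (b^~ v0)
  (GRing.isLinear.Build k U W *:%R (b^~ v0) (bl v0)).
have eu : bl_ v u = \sum_i coord (vbasis {: U}) i u *: b (vbasis {: U})`_i v.
  rewrite [in LHS](coord_vbasis (memvf u)) linear_sum.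
  by apply: eq_bigr => i _; rewrite linearZ.
have ev x : br_ x v = \sum_j coord (vbasis {: V}) j v *: b x (vbasis {: V})`_j.
  rewrite [in LHS](coord_vbasis (memvf v)) linear_sum.
  by apply: eq_bigr => j _; rewrite linearZ.
rewrite -[RHS]/(bl_ v u) eu; apply: eq_bigr => i _.
rewrite -[b _ v]/(br_ _ v) ev scaler_sumr; apply: eq_bigr => j _.
by rewrite mxE scalerA.
Qed.

Definition tensmul (A : falgType k) (X Y : tensor A A) : tensor A A :=
  tlift (fun a b => tlift (fun c d => tens (a * c) (b * d)) Y) X.

End Tensor.

(* A falgType is finite dimensional.                                          *)
Record hopfAlgebra (k : fieldType) := HopfAlgebra {
  hopf_alg :> falgType k;
  comul : {linear hopf_alg -> tensor hopf_alg hopf_alg};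
  counit : {lrmorphism hopf_alg -> k^o};
  antipode : {linear hopf_alg -> hopf_alg};
  comul1 : comul 1 = tens 1 1;
  comulM : forall a b, comul (a * b) = tensmul (comul a) (comul b);
  comulA : forall h,
    tlift (fun a b => tens (comul a) b) (comul h)
    = tlift (fun a b => tlift (fun c d => tens (tens a c) d) (comul b))
        (comul h);
  counitl : forall h, tlift (fun a b => counit a *: b) (comul h) = h;
  counitr : forall h, tlift (fun a b => counit b *: a) (comul h) = h;
  antipodel : forall h,
    tlift (fun a b => antipode a * b) (comul h) = counit h *: 1;
  antipoder : forall h,
    tlift (fun a b => a * antipode b) (comul h) = counit h *: 1 }.

Section Integrals.
Variables (k : fieldType) (H : hopfAlgebra k).

Definition convolution (f f' : 'Hom(H, k^o)) (h : H) : k^o :=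
  tlift (fun a b => f a * f' b) (comul H h).

Definition dual_right_integral (phi : 'Hom(H, k^o)) :=
  forall (f : 'Hom(H, k^o)) (h : H), convolution phi f h = f 1 * phi h.

Definition right_integral (t : H) :=
  forall h : H, t * h = counit H h *: t.

Definition nakayama_automorphism (phi : 'Hom(H, k^o)) (rho : 'AEnd(H)) :=
  bijective rho /\ forall a x : H, phi (a * x) = phi (rho x * a).

Definition modular_element (t : H) (alpha : {lrmorphism H -> k^o}) :=
  forall h : H, h * t = alpha h *: t.

Definition nakayama_component (rho : 'AEnd(H)) (w : k) : {vspace H} :=
  passmx.leigenspace rho w.

Lemma mem_nakayama_component (rho : 'AEnd(H)) (w : k) (h : H) :
  (h \in nakayama_component rho w) = (rho h == w *: h).
Proof. by rewrite memv_ker !lfun_simp subr_eq0. Qed.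

End Integrals.

Section TensorAlgebra.
Variables (k : fieldType) (n : nat) (q : 'I_n -> 'I_n -> k).

Local Notation word := {fmonom 'I_n}.

(* T(V) has as basis the words in the letters x_0, ..., x_(n-1), and          *)
(* T(V) (x) T(V) the pairs of words.                                          *)
Definition tensorAlgebra := {malg k[word]}.
Definition tensorAlgebra2 := {malg k[(word * word)%type]}.

Local Notation T := tensorAlgebra.
Local Notation TT := tensorAlgebra2.

Definition tvar (i : 'I_n) : T := << fmu i >>.

(* c(u (x) v) = (braid u v) v (x) u for words u and v.                        *)
Definition braid (u v : word) : k :=
  \prod_(i <- (u : seq _)) \prod_(j <- (v : seq _)) q i j.

Definition ttens (a b : T) : TT :=
  \sum_(u <- msupp a) \sum_(v <- msupp b) << a@_u * b@_v *g (u, v) >>.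

(* (u (x) v)(u' (x) v') = u c(v (x) u') v'                                    *)
Definition ttmul (X Y : TT) : TT :=
  \sum_(x <- msupp X) \sum_(y <- msupp Y)
    << X@_x * Y@_y * braid x.2 y.1 *g (mmul x.1 y.1, mmul x.2 y.2) >>.

(* The algebra map T(V) -> T(V) (x) T(V) for which the x_i are primitive.     *)
Definition tcomul_word (w : word) : TT :=
  \big[ttmul / ttens 1 1]_(i <- (w : seq _))
    (ttens (tvar i) 1 + ttens 1 (tvar i)).

Definition tcomul (p : T) : TT :=
  \sum_(w <- msupp p) p@_w *: tcomul_word w.

Definition tcounit (p : T) : k := p@_(mone : word).

Definition homogeneous (d : nat) (p : T) :=
  forall w, w \in msupp p -> fdeg w = d.

Definition tcomponent (d : nat) (p : T) : T :=
  \sum_(w <- msupp p | fdeg w == d) << p@_w *g w >>.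

Definition tideal (I : T -> Prop) :=
  [/\ I 0, forall a b, I a -> I b -> I (a + b)
    & forall a b, I b -> I (a * b) /\ I (b * a)].

Definition homogeneous_ideal (I : T -> Prop) :=
  tideal I /\ forall d p, I p -> I (tcomponent d p).

Definition generated_in_degree_ge2 (I : T -> Prop) :=
  forall J, tideal J ->
    (forall d p, (2 <= d)%N -> homogeneous d p -> I p -> J p) ->
  forall p, I p -> J p.

(* Delta(I) is contained in I (x) T + T (x) I, and epsilon(I) = 0.            *)
Definition tcoideal (I : T -> Prop) :=
  forall p, I p -> tcounit p = 0 /\
    exists s : seq (T * T),
      (forall ab, ab \in s -> I ab.1 \/ I ab.2)
      /\ tcomul p = \sum_(ab <- s) ttens ab.1 ab.2.

Definition nichols_relations (I : T -> Prop) :=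
  [/\ homogeneous_ideal I, generated_in_degree_ge2 I & tcoideal I].

(* The Nichols algebra of the braided vector space (V, c), assumed to be      *)
(* finite dimensional, presented as an algebra quotient of T(V).              *)
Record nicholsAlgebra := NicholsAlgebra {
  nichols_alg :> falgType k;
  nichols_proj : {lrmorphism T -> nichols_alg};
  nichols_surj : forall r, exists p, nichols_proj p = r;
  nichols_ker : nichols_relations (fun p => nichols_proj p = 0);
  nichols_ker_largest : forall I, nichols_relations I ->
    forall p, I p -> nichols_proj p = 0 }.

Definition nichols_var (R : nicholsAlgebra) (i : 'I_n) : R :=
  nichols_proj R (tvar i).

End TensorAlgebra.

Section Bosonization.
Variables (k : fieldType) (gT : finGroupType) (n : nat).
Variables (g : 'I_n -> gT) (chi : 'I_n -> gT -> k).

Definition is_character (f : gT -> k) :=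
  f 1%g = 1 /\ forall x y, f (x * y)%g = f x * f y.

Definition braiding_matrix (i j : 'I_n) : k := chi j (g i).

(* By bos_bij, H is R (x) kG as a vector space: the function r stands for the *)
(* sum of the r(x) (x) x. The remaining equations determine the Hopf algebra  *)
(* structure on it, since the x_i generate R.                                 *)
Record bosonization (R : nicholsAlgebra braiding_matrix) := Bosonization {
  bos_hopf :> hopfAlgebra k;
  bos_R : {lrmorphism R -> bos_hopf};
  bos_G : gT -> bos_hopf;
  bos_G1 : bos_G 1%g = 1;
  bos_GM : forall x y, bos_G (x * y)%g = bos_G x * bos_G y;
  bos_bij : bijective (fun r : {ffun gT -> R} =>
    \sum_x bos_R (r x) * bos_G x);
  bos_comm : forall x i, bos_G x * bos_R (nichols_var R i)
    = chi i x *: (bos_R (nichols_var R i) * bos_G x);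
  bos_comulG : forall x, comul bos_hopf (bos_G x) = tens (bos_G x) (bos_G x);
  bos_comulR : forall i, comul bos_hopf (bos_R (nichols_var R i))
    = tens (bos_G (g i)) (bos_R (nichols_var R i))
      + tens (bos_R (nichols_var R i)) 1;
  bos_counitG : forall x, counit bos_hopf (bos_G x) = 1;
  bos_counitR : forall i, counit bos_hopf (bos_R (nichols_var R i)) = 0;
  bos_antipodeG : forall x, antipode bos_hopf (bos_G x) = bos_G (x^-1)%g;
  bos_antipodeR : forall i, antipode bos_hopf (bos_R (nichols_var R i))
    = - (bos_G ((g i)^-1)%g * bos_R (nichols_var R i)) }.

End Bosonization.

(* The subgroup of k^* generated by a set X of nonzero elements.              *)
Inductive gen_subgroup (k : fieldType) (X : k -> Prop) : k -> Prop :=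
| gen_in w of X w : gen_subgroup X w
| gen_1 : gen_subgroup X 1
| gen_mul v w of gen_subgroup X v & gen_subgroup X w : gen_subgroup X (v * w)
| gen_inv w of gen_subgroup X w : gen_subgroup X w^-1.

(* Gradings by a subgroup L of k^*; only the components indexed by L matter.  *)
Section Gradings.
Variables (k : fieldType) (A : falgType k).
Variables (L : k -> Prop) (A_ : k -> {vspace A}).

Definition is_grading :=
  [/\ forall s : seq k, uniq s -> (forall w, w \in s -> L w) ->
        directv (\sum_(w <- s) A_ w),
      exists s : seq k, (forall w, w \in s -> L w)
        /\ (\sum_(w <- s) A_ w)%VS = fullv,
      1 \in A_ 1
    & forall v w, L v -> L w -> (A_ v * A_ w <= A_ (v * w))%VS].

Definition strongly_graded :=
  is_grading /\ forall v w, L v -> L w -> (A_ v * A_ w)%VS = A_ (v * w).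

Definition crossed_product :=
  forall w, L w -> exists2 u, u \in A_ w & u \is a GRing.unit.

End Gradings.

Section Proposition.
Variables (k : fieldType) (gT : finGroupType) (n : nat).
Variables (g : 'I_n -> gT) (chi : 'I_n -> gT -> k).
Variables (R : nicholsAlgebra (braiding_matrix g chi)).
Variables (H : bosonization R).

Definition L2 (alpha : H -> k) (w : k) := exists x, w = alpha (bos_G H x).

Definition L1 (alpha : H -> k) : k -> Prop :=
  gen_subgroup (fun w => (exists i, w = braiding_matrix g chi i i)
                         \/ L2 alpha w).

End Proposition.

(* Main.v *)
Require Import Defs.
From HB Require Import structures.
From mathcomp Require Import all_boot all_fingroup all_algebra all_field.
From mathcomp Require Import finmap monalg.

(** Write x_i and g for the images in H of the generators of R and of the
elements of G, and let phi and t be the two integrals. Everything rests on the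
values rho(g) = alpha(g)^-1 g and rho(x_i) = alpha(g_i)^-1 q_ii^-1 x_i.

To find these values, slice the coproduct of t: put F(b) = phi(t_1 b) t_2
([slicer]) and E(u) = phi(u t_1) t_2 ([slicel]). The defining property of rho
says that F = E o rho. Since phi is an integral, F(1) = E(1) = phi(t) 1. Taking
the coproduct of the relations t g = t and t x_i = 0 gives
F(g b) = F(b) g^-1 and F(x_i b) = - F(b) g_i^-1 x_i, and the relations
g t = alpha(g) t and x_i t = 0 likewise move g and x_i through E. Here
alpha(x_i) = 0 because x_i is nilpotent, the relations of the finite
dimensional algebra R being homogeneous ([nichols_var_nilpotent]). If phi(t)
were zero, then F would vanish, and coassociativity and the antipode would give
phi(b) t = 0 for all b ([slicer_eq0]). Hence the image of F, a right ideal that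
contains phi(t) 1, is the whole of H, so F is injective by finite dimension
([slicer_inj]), and E is injective as well. Comparing E and F on g and on x_i
then determines rho ([rho_G], [rho_var]).

Since H is generated by eigenvectors of the algebra automorphism rho whose
eigenvalues lie in L_1, the components H_w form a grading by L_1
([leigenspace_grading]).

The element g lies in the component of weight alpha(g)^-1, whence (2) => (3);
(3) => (4) because g is invertible; (4) => (1) because an invertible
homogeneous u can be divided out: h = u (u^-1 h)
([crossed_strongly_graded]). For (1) => (2), let pi : H -> kG be the algebra map
that kills the x_i ([grouplike_projection]); it commutes with rho. As
1 is in H_w H_(w^-1), the image pi(H_w) is nonzero; it lies in the w-eigenspace
of rho on kG, and the eigenvalues of rho on kG belong to alpha(G)
([strongly_graded_L2]). *)

Set Implicit Arguments.
Unset Strict Implicit.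
Unset Printing Implicit Defensive.

Import GRing.Theory.
Local Open Scope ring_scope.

(** * Linear maps out of tensor products *)

Definition bilinear_map (k : fieldType) (U V W : lmodType k)
    (b : U -> V -> W) :=
  (forall v, linear (b^~ v)) /\ (forall u, linear (b u)).

Section TensorLift.
Variables (k : fieldType) (U V : vectType k) (W W' : lmodType k).

Lemma tlift_linear (b : U -> V -> W) : linear (tlift b).
Proof.
move=> a A B; rewrite /tlift scaler_sumr -big_split; apply: eq_bigr => i _ /=.
rewrite scaler_sumr -big_split; apply: eq_bigr => j _ /=.
by rewrite !mxE scalerDl scalerA.
Qed.

Lemma tliftD (b : U -> V -> W) A B : tlift b (A + B) = tlift b A + tlift b B.
Proof. by rewrite -[A]scale1r tlift_linear !scale1r. Qed.

Lemma tlift0 (b : U -> V -> W) : tlift b 0 = 0.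
Proof.
by rewrite -[0](subrr 0) -scaleN1r addrC tlift_linear scaleN1r addNr.
Qed.

Lemma tliftZ (b : U -> V -> W) a A : tlift b (a *: A) = a *: tlift b A.
Proof. by rewrite -[a *: A]addr0 tlift_linear tlift0 addr0. Qed.

Lemma eq_tlift (b b' : U -> V -> W) A :
  (forall u v, b u v = b' u v) -> tlift b A = tlift b' A.
Proof.
by move=> e; apply: eq_bigr => i _; apply: eq_bigr => j _; rewrite e.
Qed.

Lemma linear_tlift (f : W -> W') (b : U -> V -> W) A : linear f ->
  f (tlift b A) = tlift (fun u v => f (b u v)) A.
Proof.
move=> lf; pose f_ : {linear W -> W'} := HB.pack f
  (GRing.isLinear.Build k W W' *:%R f lf).
rewrite -[f _]/(f_ _) linear_sum; apply: eq_bigr => i _.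
by rewrite linear_sum; apply: eq_bigr => j _; rewrite linearZ.
Qed.

Lemma tlift_fun_linear (b : W' -> U -> V -> W) A :
  (forall u v, linear (fun w => b w u v)) -> linear (fun w => tlift (b w) A).
Proof.
move=> lb a w w'; rewrite /tlift scaler_sumr -big_split.
apply: eq_bigr => i _ /=.
rewrite scaler_sumr -big_split; apply: eq_bigr => j _ /=.
by rewrite lb scalerDr !scalerA mulrC.
Qed.

Lemma tlift_sum (I : finType) (b : I -> U -> V -> W) A :
  tlift (fun u v => \sum_i b i u v) A = \sum_i tlift (b i) A.
Proof.
rewrite /tlift [RHS]exchange_big; apply: eq_bigr => i _ /=.
rewrite [RHS]exchange_big; apply: eq_bigr => j _ /=.
by rewrite scaler_sumr.
Qed.

Lemma tens_bilinear : bilinear_map (@tens k U V).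
Proof.
split=> [v|u] a x y; apply/matrixP => i j; rewrite !mxE linearP /=.
  by rewrite mulrDl mulrA.
by rewrite mulrDr mulrCA.
Qed.

Lemma tlift_tensE (b : U -> V -> W) u v : bilinear_map b ->
  tlift b (tens u v) = b u v.
Proof. by case=> *; apply: tlift_tens. Qed.

End TensorLift.

Lemma tlift_tlift_tens (k : fieldType) (U V U' V' : vectType k)
    (W : lmodType k) (b : U -> V -> W) (f : U' -> V' -> U) (g : U' -> V' -> V)
    A : bilinear_map b ->
  tlift b (tlift (fun u v => tens (f u v) (g u v)) A)
  = tlift (fun u v => b (f u v) (g u v)) A.
Proof.
move=> bb; rewrite (linear_tlift _ _ (tlift_linear b)).
by apply: eq_tlift => u v; rewrite tlift_tensE.
Qed.

Section TensorProductAlgebra.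
Variables (k : fieldType) (A : falgType k).
Implicit Types (X Y : tensor A A) (p q : A).

Lemma tensmul_bilinear : bilinear_map (@tensmul k A).
Proof.
split=> [Y|X] a B C; first exact: tlift_linear.
rewrite /tensmul; apply: (tlift_fun_linear (W' := tensor A A)
  (b := fun w a b => tlift (fun c d => tens (a * c) (b * d)) w)).
by move=> u v; apply: tlift_linear.
Qed.

Lemma tens_mul_bilinear p q :
  bilinear_map (fun c d => tens (p * c) (q * d) : tensor A A).
Proof.
have [tl tr] := tens_bilinear A A.
by split=> [v|u] a x y; rewrite mulrDr -scalerAr ?tl ?tr.
Qed.

Lemma tensmul_tensr X p q :
  tensmul X (tens p q) = tlift (fun a b => tens (a * p) (b * q)) X.
Proof.
by apply: eq_tlift => a b; rewrite tlift_tensE //; apply: tens_mul_bilinear.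
Qed.

Lemma tensmul_tensl Y p q :
  tensmul (tens p q) Y = tlift (fun c d => tens (p * c) (q * d)) Y.
Proof.
have [tl tr] := tens_bilinear A A.
rewrite /tensmul tlift_tens // => [v|u].
  apply: (tlift_fun_linear (b := fun w c d => tens (w * c) (v * d)))
    => c d a x y.
  by rewrite mulrDl -scalerAl tl.
apply: (tlift_fun_linear (b := fun w c d => tens (u * c) (w * d))) => c d a x y.
by rewrite mulrDl -scalerAl tr.
Qed.

Variables (W : lmodType k) (b : A -> A -> W) (bb : bilinear_map b).

Lemma tlift_tensmulr X p q :
  tlift b (tensmul X (tens p q)) = tlift (fun c d => b (c * p) (d * q)) X.
Proof. by rewrite tensmul_tensr tlift_tlift_tens. Qed.

Lemma tlift_tensmull Y p q :
  tlift b (tensmul (tens p q) Y) = tlift (fun c d => b (p * c) (q * d)) Y.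
Proof. by rewrite tensmul_tensl tlift_tlift_tens. Qed.

End TensorProductAlgebra.

(** * Slicing the coproduct of an element by an integral *)

Section IntegralSlices.
Variables (k : fieldType) (H : hopfAlgebra k) (phi : 'Hom(H, k^o)) (t : H).
Hypothesis phi_int : dual_right_integral phi.

(** In Sweedler notation these are phi(u t_1) t_2 and phi(t_1 b) t_2. *)
Definition slicel (u : H) : H :=
  tlift (fun c d => phi (u * c) *: d) (comul H t).
Definition slicer (b : H) : H :=
  tlift (fun c d => phi (c * b) *: d) (comul H t).

Lemma slicel_bilinear u : bilinear_map (fun c d : H => phi (u * c) *: d).
Proof.
split=> [v|c] a x y; first by rewrite mulrDr -scalerAr linearP scalerDl scalerA.
by rewrite scalerDr !scalerA mulrC.
Qed.

Lemma slicer_bilinear b : bilinear_map (fun c d : H => phi (c * b) *: d).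
Proof.
split=> [v|c] a x y; first by rewrite mulrDl -scalerAl linearP scalerDl scalerA.
by rewrite scalerDr !scalerA mulrC.
Qed.

Lemma slicel_linear : linear slicel.
Proof.
apply: tlift_fun_linear => c d a x y.
by rewrite mulrDl -scalerAl linearP scalerDl scalerA.
Qed.

Lemma slicer_linear : linear slicer.
Proof.
apply: tlift_fun_linear => c d a x y.
by rewrite mulrDr -scalerAr linearP scalerDl scalerA.
Qed.

(** This turns an identity of functionals, such as the definition of an
integral, into an identity in H. *)
Lemma eq_coord (x y : H) : (forall f : 'Hom(H, k^o), f x = f y) -> x = y.
Proof.
move=> e; rewrite (coord_vbasis (memvf x)) (coord_vbasis (memvf y)).
apply: eq_bigr => i _; congr (_ *: _).
by have := e (linfun (coord (vbasis {:H}) i : H -> k^o)); rewrite !lfunE.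
Qed.

Lemma dual_integralE h :
  tlift (fun c d => phi c *: d) (comul H h) = phi h *: 1.
Proof.
apply: eq_coord => f; rewrite (linear_tlift (f := f)); last exact: linearP.
rewrite linearZ /= -[_ *: f 1]/(phi h * f 1) mulrC -phi_int.
by apply: eq_tlift => c d; rewrite linearZ.
Qed.

Lemma slicel1 : slicel 1 = phi t *: 1.
Proof. by rewrite -dual_integralE; apply: eq_tlift => c d; rewrite mul1r. Qed.

Lemma slicer1 : slicer 1 = phi t *: 1.
Proof. by rewrite -dual_integralE; apply: eq_tlift => c d; rewrite mulr1. Qed.

Lemma linear_mull (x : H) : linear (fun y => x * y).
Proof. by move=> a y z; rewrite mulrDr scalerAr. Qed.

Lemma linear_mulr (x : H) : linear (fun y => y * x).
Proof. by move=> a y z; rewrite mulrDl scalerAl. Qed.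

(** The next four lemmas apply the slice to the coproduct of t g, t x, g t and
x t. *)
Lemma slicer_grouplike g b : comul H g = tens g g -> t * g = t ->
  slicer (g * b) * g = slicer b.
Proof.
move=> dg tg; rewrite [in RHS]/slicer -[in RHS]tg comulM dg.
rewrite tlift_tensmulr; last exact: slicer_bilinear.
rewrite (linear_tlift (f := fun y => y * g) _ _ (linear_mulr g)).
by apply: eq_tlift => c d; rewrite mulrA scalerAl.
Qed.

Lemma slicer_skew g x b : comul H x = tens g x + tens x 1 -> t * x = 0 ->
  slicer (x * b) = - (slicer (g * b) * x).
Proof.
move=> dx tx; apply/eqP; rewrite -addr_eq0 addrC; apply/eqP.
transitivity (tlift (fun c d => phi (c * b) *: d) (comul H (t * x))).
  2: by rewrite tx linear0 tlift0.
rewrite comulM dx -[tens g x]scale1r (proj2 (tensmul_bilinear _)) scale1r.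
rewrite tliftD !tlift_tensmulr; try exact: slicer_bilinear.
congr (_ + _).
  rewrite (linear_tlift (f := fun y => y * x) _ _ (linear_mulr x)).
  by apply: eq_tlift => c d; rewrite mulrA scalerAl.
by apply: eq_tlift => c d; rewrite mulrA mulr1.
Qed.

Lemma slicel_grouplike g a u : comul H g = tens g g -> g * t = a *: t ->
  g * slicel (u * g) = a *: slicel u.
Proof.
move=> dg gt; rewrite [in RHS]/slicel -tliftZ -linearZ -gt comulM dg.
rewrite tlift_tensmull; last exact: slicel_bilinear.
rewrite (linear_tlift (f := fun y => g * y) _ _ (linear_mull g)).
by apply: eq_tlift => c d; rewrite mulrA scalerAr.
Qed.

Lemma slicel_skew g x u : comul H x = tens g x + tens x 1 -> x * t = 0 ->
  slicel (u * x) = - (x * slicel (u * g)).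
Proof.
move=> dx xt; apply/eqP; rewrite -addr_eq0 addrC; apply/eqP.
transitivity (tlift (fun c d => phi (u * c) *: d) (comul H (x * t))).
  2: by rewrite xt linear0 tlift0.
rewrite comulM dx -[tens g x]scale1r (proj1 (tensmul_bilinear _)) scale1r.
rewrite tliftD !tlift_tensmull; try exact: slicel_bilinear.
congr (_ + _).
  rewrite (linear_tlift (f := fun y => x * y) _ _ (linear_mull x)).
  by apply: eq_tlift => c d; rewrite mulrA scalerAr.
by apply: eq_tlift => c d; rewrite mulrA mul1r.
Qed.

(** Compute phi(t_1 S(t_2) b) t_3 in two ways. The antipode collapses
t_1 S(t_2), leaving phi(b) t. On the other hand the expression is obtained
from the slices phi(t_1 c) t_2, which are all zero, by applying the coproduct to
the second factor and choosing c = S(t_2) b. *)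
Lemma slicer_eq0 : (forall b, slicer b = 0) -> phi != 0 -> t = 0.
Proof.
move=> s0 phi0.
suff e b : phi b *: t = 0.
  apply/eqP/negPn/negP => t0; case/eqP: phi0; apply/lfunP => b.
  rewrite lfunE /=.
  by move/eqP: (e b); rewrite scaler_eq0 (negPf t0) orbF => /eqP.
pose S := antipode H.
(* B sends (c (x) d) (x) e to phi(c S(d) b) e. *)
pose B (X : tensor H H) (e : H) :=
  tlift (fun c d => phi (c * (S d * b)) : k^o) X *: e.
have Bb : bilinear_map B.
  split=> [v|u] a x y; rewrite /B.
    by rewrite tlift_linear scalerDl scalerA.
  by rewrite scalerDr !scalerA mulrC.
have cSb : bilinear_map (fun c d => phi (c * (S d * b)) : k^o).
  split=> [v|u] a x y; first by rewrite mulrDl -scalerAl linearP.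
  by rewrite linearP mulrDl -scalerAl mulrDr -scalerAr linearP.
transitivity (tlift B (tlift (fun a e => tens (comul H a) e) (comul H t))).
  rewrite tlift_tlift_tens //.
  have -> : phi b *: t =
      tlift (fun a e => phi b *: (counit H a *: e : H)) (comul H t).
    rewrite -[in LHS](counitl t).
    apply: (@linear_tlift k H H H H (fun y => phi b *: y)).
    by move=> c x y; rewrite scalerDr !scalerA mulrC.
  apply: (@eq_tlift k H H H) => a e; rewrite /B scalerA; congr (_ *: _).
  transitivity (phi (counit H a *: 1 * b)).
    by rewrite -scalerAl mul1r linearZ mulrC.
  rewrite -antipoder (linear_tlift (f := fun y => phi (y * b) : k^o)).
    by apply: (@eq_tlift k H H k^o) => c d; rewrite mulrA.
  by move=> c x y; rewrite mulrDl -scalerAl linearP.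
rewrite comulA (linear_tlift _ _ (tlift_linear B)).
(* Expand the coproduct of the second factor in coordinates, so that S(t_2) b
   becomes a constant in each term. *)
transitivity (\sum_(i < \dim {:H}) \sum_(j < \dim {:H})
  tlift (fun u v : H => phi (u * (S (vbasis {:H})`_i * b))
                    *: (comul H v i j *: (vbasis {:H})`_j)) (comul H t)).
  under eq_bigr do rewrite -tlift_sum.
  rewrite -tlift_sum; apply: (@eq_tlift k H H H) => u v.
  rewrite tlift_tlift_tens //; apply: eq_bigr => i _; apply: eq_bigr => j _.
  by rewrite /B tlift_tensE // !scalerA mulrC.
rewrite big1 // => i _; rewrite big1 // => j _.
set c := S _ * b; set e := _`_j.
transitivity ((fun y : H => comul H y i j *: e) (slicer c)).
  have le : linear (fun y : H => comul H y i j *: e).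
    by move=> a x y; rewrite linearP !mxE scalerDl scalerA.
  symmetry; apply: etrans (linear_tlift _ _ le) _.
  by apply: (@eq_tlift k H H H) => u v; rewrite linearZ mxE scalerA.
by rewrite s0 /= linear0 mxE scale0r.
Qed.

End IntegralSlices.

(** * Words in a Nichols algebra *)

Section NicholsAlgebra.
Variables (k : fieldType) (n : nat) (q : 'I_n -> 'I_n -> k).
Local Notation T := (tensorAlgebra k n).

Lemma word_tvar (s : seq 'I_n) :
  (<< FMonom s >> : T) = \prod_(i <- s) @tvar k n i.
Proof.
elim: s => [|i s IHs]; first by rewrite big_nil -fmoneE.
rewrite big_cons -IHs /tvar malgM_def fgmulUU mulr1; congr << _ *g _ >>.
by rewrite fmuE -[mmul _ _]/(fmmul _ _) fmmulE.
Qed.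

Lemma tvarX i m : (@tvar k n i) ^+ m = << FMonom (nseq m i) >>.
Proof.
rewrite word_tvar; elim: m => [|m IHm]; first by rewrite big_nil.
by rewrite /= big_cons exprS IHm.
Qed.

Lemma scale_word a (w : {fmonom 'I_n}) : a *: (<< w >> : T) = << a *g w >>.
Proof. by rewrite -mul_malgC malgM_def fgmulUU mulr1 mul1m. Qed.

Lemma tensorAlgebraE (p : T) :
  p = \sum_(w <- msupp p) p@_w *: \prod_(i <- (w : seq 'I_n)) @tvar k n i.
Proof.
rewrite [LHS]monalgE; apply: eq_bigr => -[s] _.
by rewrite -word_tvar scale_word.
Qed.

Lemma tcomponentE d (p : T) w :
  (tcomponent d p)@_w = if fdeg w == d then p@_w else 0.
Proof.
rewrite /tcomponent raddf_sum /=; case: ifP => [dw|ndw]; last first.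
  rewrite big1 // => v /eqP dv; rewrite mcoeffU.
  by case: eqP => // vw; rewrite -vw dv eqxx in ndw.
case: (boolP (w \in msupp p)) => [wp|wp].
  rewrite (big_rem w) //= dw mcoeffUU big1_seq ?addr0 // => v /andP[_ vp].
  rewrite mcoeffU; case: eqP => // vw.
  by move: vp; rewrite vw mem_rem_uniqF ?fset_uniq.
rewrite (mcoeff_outdom wp) big1_seq // => v /andP[_ vp]; rewrite mcoeffU.
by case: eqP => // vw; rewrite -vw vp in wp.
Qed.

Lemma tcomponent_powers (m : nat) (c : 'I_m -> k) (i : 'I_n) (d : 'I_m) :
  tcomponent d (\sum_j c j *: (@tvar k n i) ^+ j) = c d *: (@tvar k n i) ^+ d.
Proof.
have X a j : a *: (@tvar k n i) ^+ j = << a *g FMonom (nseq j i) >>.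
  by rewrite tvarX scale_word.
rewrite X; under eq_bigr do rewrite X.
apply/malgP => w; rewrite tcomponentE raddf_sum mcoeffU (bigD1 d) //= mcoeffU.
case: ifP => [/eqP dw|ndw].
  rewrite big1 ?addr0 // => j jd; rewrite mcoeffU.
  case: eqP => [jw|] //.
  by move: dw jd; rewrite -jw fdegE /= size_nseq => /val_inj ->; rewrite eqxx.
case: eqP => [jw|] //.
by move: ndw; rewrite -jw fdegE /= size_nseq eqxx.
Qed.

(** If no power of x up to the dimension of R vanished, these powers would be
dependent, and the homogeneous components of a relation between them are
multiples of single powers. *)
Lemma nichols_var_nilpotent (R : nicholsAlgebra q) i :
  exists m, (nichols_var R i) ^+ m = 0.
Proof.
set x := nichols_var R i.
pose N := (\dim {:R}).+1.
pose X : N.-tuple R := [tuple x ^+ j | j < N].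
have nX (j : 'I_N) : X`_j = x ^+ j by rewrite -tnth_nth tnth_mktuple.
have /freeP nf : ~~ free X.
  apply/negP => /eqP f.
  by have := dimvS (subvf <<X>>%VS); rewrite f size_tuple ltnn.
case: (boolP [exists j : 'I_N, x ^+ j == 0]) => [/existsP[j /eqP]|/existsPn x0].
  by exists j.
case: nf => c c0 j.
have [[_ hcomp] _ _] := nichols_ker R.
pose p : T := \sum_j c j *: (@tvar k n i) ^+ j.
have p0 : nichols_proj R p = 0.
  rewrite /p linear_sum -[RHS]c0; apply: eq_bigr => l _.
  by rewrite linearZ rmorphXn nX.
move: (hcomp j p p0); rewrite tcomponent_powers linearZ rmorphXn /=.
by move/eqP; rewrite scaler_eq0 (negPf (x0 j)) orbF => /eqP.
Qed.

End NicholsAlgebra.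

(** * Gradings by eigenspaces of an algebra endomorphism *)

Lemma gen_subgroup_neq0 (k : fieldType) (X : k -> Prop) :
  (forall w, X w -> w != 0) -> forall w, gen_subgroup X w -> w != 0.
Proof.
move=> X0 w; elim=> {w} [w /X0 //||v w _ v0 _ w0|w _ w0]; rewrite ?oner_eq0 //.
  by rewrite mulf_neq0.
by rewrite invr_eq0.
Qed.

Section Eigenspaces.
Variables (k : fieldType) (V : vectType k) (f : 'End(V)).
Local Notation E w := (passmx.leigenspace f w).

Lemma mem_leigenspace w v : (v \in E w) = (f v == w *: v).
Proof. by rewrite memv_ker !lfun_simp subr_eq0. Qed.

(** It kills the eigenspaces with eigenvalue in s and is invertible on the
others, which separates them. *)
Definition eigen_killer (s : seq k) : 'End(V) :=
  foldr (fun v F => (F \o (f - v *: \1))%VF) \1%VF s.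

Lemma eigen_killerE s w v : v \in E w ->
  eigen_killer s v = (\prod_(u <- s) (w - u)) *: v.
Proof.
rewrite mem_leigenspace => /eqP fv; elim: s => [|u s IHs] /=.
  by rewrite big_nil lfunE scale1r.
rewrite comp_lfunE !lfun_simp fv -scalerBl linearZ /= IHs scalerA.
by rewrite big_cons.
Qed.

Lemma leigenspace_cap_sum (s : seq k) w : w \notin s ->
  (E w :&: \sum_(v <- s) E v)%VS = 0%VS.
Proof.
move=> ws; apply/eqP; rewrite -subv0; apply/subvP => x.
rewrite memv_cap memv0 => /andP[xw xs].
have : eigen_killer s x = 0.
  apply/eqP; rewrite -memv_ker; apply: subvP xs; rewrite big_seq.
  elim/big_ind: _ => [|U W sU sW|v vs]; rewrite ?sub0v ?subv_add ?sU //.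
  apply/subvP => y yv; rewrite memv_ker (eigen_killerE s yv).
  by rewrite (big_rem v) //= subrr mul0r scale0r.
move=> /eqP; rewrite (eigen_killerE s xw) scaler_eq0 prodf_seq_eq0.
case/orP => // /hasP[v vs /=]; rewrite subr_eq0 => /eqP wv.
by rewrite wv vs in ws.
Qed.

Lemma directv_leigenspace (s : seq k) : uniq s -> directv (\sum_(w <- s) E w).
Proof.
rewrite directvE /=; elim: s => [|w s IHs] /=; first by rewrite !big_nil dimv0.
case/andP=> ws /IHs /eqP es.
by rewrite !big_cons dimv_disjoint_sum ?es // leigenspace_cap_sum.
Qed.

End Eigenspaces.

Section EigenGrading.
Variables (k : fieldType) (A : falgType k) (f : 'AEnd(A)) (L : k -> Prop).
Local Notation E := (passmx.leigenspace f).
Hypotheses (one_L : L 1) (mul_L : forall v w, L v -> L w -> L (v * w)).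

(** A grading needs one finite list of weights for the whole algebra; here the
list may depend on h, which lets the property be proved by induction on
products. *)
Definition spanned (h : A) := exists2 s : seq k,
  forall w, w \in s -> L w & h \in (\sum_(w <- s) E w)%VS.

Lemma leigenspace_mul v w x y : x \in E v -> y \in E w -> x * y \in E (v * w).
Proof.
rewrite !mem_leigenspace => /eqP fx /eqP fy.
by rewrite (rmorphM f x y : f _ = f x * f y) fx fy -scalerAl -scalerAr scalerA.
Qed.

Lemma leigenspace1 : 1 \in E 1.
Proof. by rewrite mem_leigenspace rmorph1 scale1r. Qed.

Lemma spanned1 : spanned 1.
Proof.
exists [:: 1] => [w|]; first by rewrite inE => /eqP->.
by rewrite big_seq1 leigenspace1.
Qed.

Lemma spanned_linear a x y : spanned x -> spanned y -> spanned (a *: x + y).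
Proof.
case=> s sL xs [s' s'L ys]; exists (s ++ s') => [w|].
  by rewrite mem_cat => /orP[/sL|/s'L].
by rewrite big_cat memv_add ?memvZ.
Qed.

Lemma spanned_mulr v y x : L v -> y \in E v -> spanned x -> spanned (x * y).
Proof.
move=> Lv yv [s sL xs]; exists [seq w * v | w <- s] => [_ /mapP[w /sL ws ->]|].
  exact: mul_L.
elim: s {sL} x xs => [|w s IHs] x /=; rewrite ?big_nil ?big_cons.
  by rewrite !memv0 => /eqP->; rewrite mul0r.
case/memv_addP=> u uw [z zs ->]; rewrite mulrDl memv_add ?IHs //.
exact: leigenspace_mul.
Qed.

(** Concatenating the weights needed for the vectors of a basis gives a list
that serves for all of A. *)
Lemma leigenspace_grading : (forall h, spanned h) -> is_grading L E.
Proof.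
move=> sp; split=> [s us _||| v w _ _].
- exact: directv_leigenspace.
- suff [s sL ss] : exists2 s : seq k, (forall w, w \in s -> L w)
      & (<<vbasis {:A}>> <= \sum_(w <- s) E w)%VS.
    exists s; split=> //; apply/eqP; rewrite eqEsubv subvf.
    by rewrite -(span_basis (vbasisP {:A})).
  elim: (vbasis {:A} : seq A) => [|x X [s sL Xs]].
    by exists [::] => //; rewrite span_nil sub0v.
  have [s' s'L xs] := sp x; exists (s' ++ s) => [w|].
    by rewrite mem_cat => /orP[/s'L|/sL].
  by rewrite span_cons big_cat addvS // -memvE.
- exact: leigenspace1.
- by apply/prodvP => x y; apply: leigenspace_mul.
Qed.

(** If u is a unit of weight v, then u^-1 has weight v^-1, so that
h = u (u^-1 h) factors every h of weight v w. *)
Lemma crossed_strongly_graded : is_grading L E ->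
  crossed_product L E -> strongly_graded L E.
Proof.
move=> gr cr; split=> // v w Lv Lw; have [_ _ _ grM] := gr.
apply/eqP; rewrite eqEsubv grM //=; apply/subvP => h hvw.
have [u uv uU] := cr v Lv; rewrite -(mulVKr uU h); apply: memv_mul => //.
move: uv hvw; rewrite !mem_leigenspace => /eqP fu /eqP fh.
have v0 : v != 0.
  apply/eqP => v0; move: (rmorph_unit f uU : f u \is a GRing.unit).
  by rewrite fu v0 scale0r unitr0.
rewrite (rmorphM f _ h : f _ = f u^-1 * f h) (rmorphV f uU : f _ = (f u)^-1).
rewrite fu fh invrZ ?unitfE // -scalerAl -scalerAr scalerA.
by rewrite mulKf.
Qed.

End EigenGrading.

(** * Generators of the bosonization *)

Section Bosonization.
Variables (k : fieldType) (gT : finGroupType) (n : nat).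
Variables (g : 'I_n -> gT) (chi : 'I_n -> gT -> k).
Variables (R : nicholsAlgebra (braiding_matrix g chi)) (H : bosonization R).

Definition bos_var (i : 'I_n) : H := bos_R H (nichols_var R i).

Lemma bos_R_span (P : H -> Prop) :
    (forall s : seq 'I_n, P (\prod_(i <- s) bos_var i)) ->
    (forall a u v, P u -> P v -> P (a *: u + v)) ->
  forall r, P (bos_R H r).
Proof.
move=> Pm Pl r; have [p <-] := nichols_surj r.
have P0 : P 0.
  rewrite -(addNr (\prod_(i <- [::]) bos_var i)) -scaleN1r.
  by apply: (Pl).
rewrite [p]tensorAlgebraE !linear_sum /=; elim/big_rec: _ => //= w y _ Py.
rewrite !linearZ; apply: (Pl) => //; rewrite !rmorph_prod; exact: Pm.
Qed.

Lemma bos_span (P : H -> Prop) :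
    (forall (s : seq 'I_n) x, P ((\prod_(i <- s) bos_var i) * bos_G H x)) ->
    (forall a u v, P u -> P v -> P (a *: u + v)) ->
  forall h, P h.
Proof.
move=> Pm Pl h.
have P0 : P 0.
  rewrite -(addNr ((\prod_(i <- [::]) bos_var i) * bos_G H 1%g)) -scaleN1r.
  by apply: (Pl).
have [r _ rK] := bos_bij H; rewrite -[h]rK.
elim/big_rec: _ => //= x y _ Py; rewrite -[_ * _]scale1r; apply: (Pl) => //.
apply: (bos_R_span (P := fun u => P (u * bos_G H x))) => // a u v Pu Pv.
by rewrite mulrDl -scalerAl; apply: (Pl).
Qed.

(** Both induction principles say that H is generated by the g and the x_i; the
side on which a generator is added matters for maps such as [slicer], which
turn left multiplication into right multiplication. *)
Lemma bos_ind_l (P : H -> Prop) : P 1 ->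
    (forall a u v, P u -> P v -> P (a *: u + v)) ->
    (forall x u, P u -> P (bos_G H x * u)) ->
    (forall i u, P u -> P (bos_var i * u)) ->
  forall h, P h.
Proof.
move=> P1 Pl PG PV; apply: bos_span => // s x; elim: s => [|i s IHs].
  by rewrite big_nil mul1r -[bos_G H x]mulr1; apply: (PG).
by rewrite big_cons -mulrA; apply: (PV).
Qed.

Lemma bos_ind_r (P : H -> Prop) : P 1 ->
    (forall a u v, P u -> P v -> P (a *: u + v)) ->
    (forall x u, P u -> P (u * bos_G H x)) ->
    (forall i u, P u -> P (u * bos_var i)) ->
  forall h, P h.
Proof.
move=> P1 Pl PG PV; apply: bos_span => // s x; apply: (PG).
elim/last_ind: s => [|s i IHs]; first by rewrite big_nil.
by rewrite -cats1 big_cat big_seq1; apply: (PV).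
Qed.

Lemma bos_GV x : bos_G H (x^-1)%g * bos_G H x = 1.
Proof. by rewrite -bos_GM mulVg bos_G1. Qed.

Lemma bos_VG x : bos_G H x * bos_G H (x^-1)%g = 1.
Proof. by rewrite -bos_GM mulgV bos_G1. Qed.

Lemma bos_G_unit x : bos_G H x \is a GRing.unit.
Proof. by apply/unitrP; exists (bos_G H (x^-1)%g); rewrite bos_GV bos_VG. Qed.

Lemma bos_G_free (c : gT -> k) :
  \sum_x c x *: bos_G H x = 0 -> forall x, c x = 0.
Proof.
move=> c0 x; have bi := bij_inj (bos_bij H).
have e : [ffun y => c y *: (1 : R)] = [ffun=> 0].
  apply: bi; rewrite [RHS]big1 => [|y _]; last by rewrite ffunE linear0 mul0r.
  rewrite -[RHS]c0; apply: eq_bigr => y _.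
  by rewrite ffunE linearZ rmorph1 -scalerAl mul1r.
move/ffunP/(_ x): e; rewrite !ffunE => /eqP.
by rewrite scaler_eq0 oner_eq0 orbF => /eqP.
Qed.

Lemma bos_GX x i : bos_G H x * bos_var i = chi i x *: (bos_var i * bos_G H x).
Proof. exact: bos_comm. Qed.

Lemma bos_comul_var i : comul H (bos_var i)
  = tens (bos_G H (g i)) (bos_var i) + tens (bos_var i) 1.
Proof. exact: bos_comulR. Qed.

(** The map is r # x |-> epsilon(r) x. It is multiplicative because
epsilon(x_i) = 0 and moving x_i to the left of a group element only multiplies
it by a scalar, so that right multiplication by x_i lands in the kernel. *)
Lemma grouplike_projection : exists pi : 'End(H),
  [/\ forall h h', pi (h * h') = pi h * pi h',
      forall x, pi (bos_G H x) = bos_G H x,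
      forall i, pi (bos_var i) = 0
    & forall h, exists c : gT -> k, pi h = \sum_x c x *: bos_G H x].
Proof.
have [rr rrK rK] := bos_bij H.
pose e (r : R) : k := counit H (bos_R H r).
have eD a r r' : e (a *: r + r') = a * e r + e r' by rewrite /e !linearP.
have eM r r' : e (r * r') = e r * e r' by rewrite /e !rmorphM.
pose toH (r : {ffun gT -> R}) : H := \sum_x bos_R H (r x) * bos_G H x.
have toHl a r r' : toH (a *: r + r') = a *: toH r + toH r'.
  rewrite /toH scaler_sumr -big_split; apply: eq_bigr => x _ /=.
  by rewrite !ffunE linearP mulrDl scalerAl.
have rl a h h' : rr (a *: h + h') = a *: rr h + rr h'.
  by apply: (can_inj rrK); rewrite -!/(toH _) toHl /toH !rK.
pose pi (h : H) : H := \sum_x e (rr h x) *: bos_G H x.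
have pil : linear pi.
  move=> a h h'; rewrite /pi scaler_sumr -big_split; apply: eq_bigr => x _ /=.
  by rewrite rl !ffunE eD scalerDl scalerA.
have piRG r x : pi (bos_R H r * bos_G H x) = e r *: bos_G H x.
  have -> : bos_R H r * bos_G H x = toH [ffun y => if y == x then r else 0].
    rewrite /toH (bigD1 x) //= ffunE eqxx big1 ?addr0 // => y /negPf yx.
    by rewrite ffunE yx linear0 mul0r.
  rewrite /pi rrK (bigD1 x) //= ffunE eqxx big1 ?addr0 // => y /negPf yx.
  by rewrite ffunE yx /e !linear0 scale0r.
pose piL : {linear H -> H} :=
  HB.pack pi (GRing.isLinear.Build k H H *:%R pi pil).
have piD : forall h h', pi (h + h') = pi h + pi h' by apply: (linearD piL).
have piZ : forall a h, pi (a *: h) = a *: pi h by apply: (linearZ_LR piL).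
have piG x : pi (bos_G H x) = bos_G H x.
  rewrite -[in LHS](mul1r (bos_G H x)) -(rmorph1 (bos_R H)) piRG.
  by rewrite /e !rmorph1 scale1r.
have eV i : e (nichols_var R i) = 0 by apply: bos_counitR.
have piV i : pi (bos_var i) = 0.
  by rewrite -[bos_var i]mulr1 -(bos_G1 H) piRG eV scale0r.
have hG h x : pi (h * bos_G H x) = pi h * bos_G H x.
  move: h; apply: bos_span => [s y|a u v IHu IHv]; last first.
    by rewrite mulrDl -scalerAl !piD !piZ IHu IHv mulrDl -scalerAl.
  by rewrite -rmorph_prod -mulrA -bos_GM !piRG bos_GM -scalerAl.
have hV h i : pi (h * bos_var i) = 0.
  move: h; apply: bos_span => [s y|a u v IHu IHv]; last first.
    by rewrite mulrDl -scalerAl piD piZ IHu IHv scaler0 addr0.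
  rewrite -mulrA bos_GX -scalerAr mulrA piZ -rmorph_prod -rmorphM piRG.
  by rewrite eM eV mulr0 scale0r scaler0.
exists (linfun pi); split=> [h h'|x|i|h]; rewrite ?lfunE //=; try exact: piG.
- have le x : linfun pi x = pi x by apply: (lfunE piL).
  rewrite !le; move: h' h.
  apply: bos_ind_r => [h|a u v IHu IHv h|x u IHu h|i u IHu h].
  + by rewrite -(bos_G1 H) hG piG.
  + by rewrite mulrDr -scalerAr !piD !piZ IHu IHv mulrDr -scalerAr.
  + by rewrite mulrA !hG IHu mulrA.
  + by rewrite mulrA !hV mulr0.
- by rewrite (lfunE piL).
- by rewrite (lfunE piL).
- by exists (fun x => e (rr h x)); rewrite (lfunE piL).
Qed.

(** * The Nakayama automorphism on generators *)

Section Nakayama.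
Variables (phi : 'Hom(H, k^o)) (rho : 'AEnd(H)) (t : H).
Variables (alpha : {lrmorphism H -> k^o}).
Hypotheses (chi_char : forall i, is_character (chi i)) (phi_neq0 : phi != 0).
Hypotheses (phi_int : dual_right_integral phi).
Hypotheses (rho_nak : nakayama_automorphism phi rho).
Hypotheses (t_neq0 : t != 0) (t_int : right_integral t).
Hypotheses (alpha_mod : modular_element t alpha).
Local Notation q i := (braiding_matrix g chi i i).

Lemma chi_neq0 i x : chi i x != 0.
Proof.
have [c1 cM] := chi_char i; apply/eqP => c0.
by have /eqP := cM x (x^-1)%g; rewrite mulgV c1 c0 mul0r oner_eq0.
Qed.

Lemma alpha_GV x : alpha (bos_G H (x^-1)%g) * alpha (bos_G H x) = 1.
Proof. by rewrite -rmorphM bos_GV rmorph1. Qed.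

Lemma alpha_neq0 x : alpha (bos_G H x) != 0.
Proof.
apply/eqP => a0; have /eqP := alpha_GV x.
by rewrite a0 mulr0 eq_sym oner_eq0.
Qed.

Lemma alphaVE x : alpha (bos_G H (x^-1)%g) = (alpha (bos_G H x))^-1.
Proof.
by apply: (mulIf (alpha_neq0 x)); rewrite alpha_GV mulVf ?alpha_neq0.
Qed.

Lemma alpha_var i : alpha (bos_var i) = 0.
Proof.
have [m xm] := nichols_var_nilpotent R i.
apply/eqP; have : alpha (bos_var i) ^+ m == 0.
  by rewrite -rmorphXn /bos_var -(rmorphXn (bos_R H)) xm !raddf0.
by rewrite expf_eq0 => /andP[].
Qed.

Lemma slicer_G x b :
  slicer phi t (bos_G H x * b) = slicer phi t b * bos_G H (x^-1)%g.
Proof.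
rewrite -(slicer_grouplike phi (g := bos_G H x) b).
- by rewrite -mulrA bos_VG mulr1.
- exact: bos_comulG.
- by rewrite t_int bos_counitG scale1r.
Qed.

Lemma slicer_var i b : slicer phi t (bos_var i * b)
  = - (slicer phi t b * bos_G H ((g i)^-1)%g * bos_var i).
Proof.
rewrite (slicer_skew phi b (bos_comul_var i)) ?slicer_G //.
by rewrite t_int [counit H _]bos_counitR scale0r.
Qed.

(** Otherwise the slice vanishes at 1, hence everywhere by the two preceding
rules, which [slicer_eq0] excludes. *)
Lemma phi_t_neq0 : phi t != 0.
Proof.
apply: contraNneq t_neq0 => pt0; apply/eqP/(slicer_eq0 _ phi_neq0).
have sl := slicer_linear phi t.
apply: bos_ind_l => [|a u v su sv|x u su|i u su].
- by rewrite slicer1 // pt0 scale0r.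
- by rewrite sl su sv scaler0 addr0.
- by rewrite slicer_G su mul0r.
- by rewrite slicer_var su !mul0r oppr0.
Qed.

(** The image contains phi(t) 1 and is stable under right multiplication by the
generators, so the slice is onto, and H is finite dimensional. *)
Lemma slicer_inj : injective (slicer phi t).
Proof.
have sl := slicer_linear phi t.
pose S : {linear H -> H} := HB.pack (slicer phi t)
  (GRing.isLinear.Build k H H *:%R _ sl).
have Ssurj h : exists b, S b = h.
  move: h; apply: bos_ind_r => [|a u v [b <-] [c <-]|x u [b <-]|i u [b <-]].
  - exists ((phi t)^-1 *: 1).
    by rewrite linearZ /= slicer1 // scalerA mulVf ?phi_t_neq0 // scale1r.
  - by exists (a *: b + c); rewrite linearP.
  - by exists (bos_G H (x^-1)%g * b); rewrite /= slicer_G invgK.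
  - exists (- (bos_var i * (bos_G H ((g i)^-1)%g * b))).
    rewrite linearN /= slicer_var slicer_G invgK opprK.
    by rewrite -(mulrA (slicer phi t b)) bos_VG mulr1.
have limgS : limg (linfun S) = fullv.
  apply/eqP; rewrite eqEsubv subvf; apply/subvP => h _.
  by have [b <-] := Ssurj h; rewrite -(lfunE S) memv_img ?memvf.
have /lker0P inj : lker (linfun S) == 0%VS.
  rewrite -dimv_eq0; have := limg_ker_dim (linfun S) fullv.
  by rewrite limgS capfv => /eqP; rewrite -[X in _ == X]add0n eqn_add2r.
have E b : linfun S b = slicer phi t b by exact: (lfunE S).
by move=> b c bc; apply: inj; rewrite !E.
Qed.

Lemma slicel_rho b : slicel phi t (rho b) = slicer phi t b.
Proof. by apply: eq_tlift => c d; rewrite -(proj2 rho_nak). Qed.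

Lemma slicel_inj : injective (slicel phi t).
Proof.
have [[rho' rhoK rho'K] _] := rho_nak; move=> u v.
by rewrite -[u]rho'K -[v]rho'K !slicel_rho => /slicer_inj->.
Qed.

Lemma slicel_G x : slicel phi t (bos_G H x)
  = (alpha (bos_G H x) * phi t) *: bos_G H (x^-1)%g.
Proof.
have := slicel_grouplike phi 1 (bos_comulG H x) (alpha_mod (bos_G H x)).
rewrite mul1r slicel1 // scalerA => e.
by rewrite -[LHS]mul1r -(bos_GV x) -mulrA e -scalerAr mulr1.
Qed.

Lemma rho_G x : rho (bos_G H x) = (alpha (bos_G H x))^-1 *: bos_G H x.
Proof.
apply: slicel_inj; rewrite slicel_rho.
have sl := slicel_linear phi t.
pose S : {linear H -> H} := HB.pack (slicel phi t)
  (GRing.isLinear.Build k H H *:%R _ sl).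
rewrite -[RHS]/(S _) linearZ /= slicel_G scalerA mulrA mulVf ?alpha_neq0 //.
rewrite mul1r.
by rewrite -[bos_G H x]mulr1 slicer_G slicer1 // -scalerAl mul1r.
Qed.

Lemma rho_var i : rho (bos_var i)
  = ((alpha (bos_G H (g i)))^-1 * (q i)^-1) *: bos_var i.
Proof.
apply: slicel_inj; rewrite slicel_rho.
have sl := slicel_linear phi t.
pose S : {linear H -> H} := HB.pack (slicel phi t)
  (GRing.isLinear.Build k H H *:%R _ sl).
have xt : bos_var i * t = 0 by rewrite alpha_mod alpha_var scale0r.
rewrite -[RHS]/(S _) linearZ /= -[X in slicel _ _ X]mul1r.
rewrite (slicel_skew phi 1 (bos_comul_var i) xt) mul1r slicel_G.
rewrite -[X in slicer _ _ X]mulr1 slicer_var slicer1 // -!scalerAl mul1r.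
rewrite scalerN -scalerAr scalerA; congr (- _).
(* Moving g_i^-1 past x_i costs the factor q_ii^-1. *)
have -> : bos_G H ((g i)^-1)%g * bos_var i
    = (q i)^-1 *: (bos_var i * bos_G H ((g i)^-1)%g).
  apply: (scalerI (chi_neq0 i (g i))).
  rewrite scalerA divff ?chi_neq0 // scale1r.
  apply: (can_inj (mulKr (bos_G_unit (g i)))).
  rewrite -scalerAr mulrA bos_VG mul1r mulrA bos_GX -scalerAl -mulrA bos_VG.
  by rewrite mulr1.
rewrite scalerA; congr (_ *: _).
by rewrite [RHS]mulrACA mulVf ?alpha_neq0 // mul1r mulrC.
Qed.

Lemma L2_L1 w : L2 alpha w -> L1 alpha w.
Proof. by move=> ?; apply: gen_in; right. Qed.

Lemma rho_G_weight x :
  bos_G H x \in nakayama_component rho (alpha (bos_G H (x^-1)%g)).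
Proof. by rewrite mem_leigenspace rho_G alphaVE. Qed.

Lemma nakayama_grading : is_grading (L1 alpha) (nakayama_component rho).
Proof.
have G_L1 x : L1 alpha (alpha (bos_G H x))^-1.
  by apply: gen_inv; apply: L2_L1; exists x.
have V_L1 i : L1 alpha ((alpha (bos_G H (g i)))^-1 * (q i)^-1).
  by apply: (gen_mul (G_L1 _)); apply: gen_inv; apply: gen_in; left; exists i.
apply: leigenspace_grading; apply: bos_ind_r.
- by apply: spanned1; apply: gen_1.
- by move=> a u v; apply: spanned_linear.
- move=> x u; apply: (spanned_mulr (@gen_mul _ _) (G_L1 x)).
  by rewrite mem_leigenspace rho_G.
- move=> i u; apply: (spanned_mulr (@gen_mul _ _) (V_L1 i)).
  by rewrite mem_leigenspace rho_var.
Qed.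

Lemma L1_neq0 w : L1 alpha w -> w != 0.
Proof.
apply: gen_subgroup_neq0 => _ [[i ->]|[x ->]]; first exact: chi_neq0.
exact: alpha_neq0.
Qed.

(** The projection of H to kG does not kill H_w, since 1 is in H_w H_(w^-1), and
it commutes with rho. A nonzero w-eigenvector of rho on kG has a group element x
in its support, and x has weight alpha(x)^-1. *)
Lemma strongly_graded_L2 w :
  strongly_graded (L1 alpha) (nakayama_component rho) ->
  L1 alpha w -> L2 alpha w.
Proof.
case=> _ sg Lw; have w0 := L1_neq0 Lw.
have [pi [piM piG piV pi_kG]] := grouplike_projection.
have rM x y : rho (x * y) = rho x * rho y by apply: rmorphM.
have rP a x y : rho (a *: x + y) = a *: rho x + rho y by apply: linearP.
have pP a x y : pi (a *: x + y) = a *: pi x + pi y by apply: linearP.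
have pi_rho h : pi (rho h) = rho (pi h).
  move: h; apply: bos_ind_r => [|a u v IHu IHv|x u IHu|i u IHu].
  + by rewrite -(bos_G1 H) rho_G linearZ /= !piG rho_G.
  + by rewrite rP !pP IHu IHv rP.
  + by rewrite rM !piM IHu rho_G linearZ /= piG rM rho_G.
  + by rewrite rM !piM rho_var linearZ /= piV scaler0 !mulr0 linear0.
pose A := nakayama_component rho.
have /subvPn [a aw pia] : ~~ (A w <= lker pi)%VS.
  apply/negP => Ak.
  have /subvP /(_ 1) : (A w * A w^-1 <= lker pi)%VS.
    apply/prodvP => x y /(subvP Ak) + _; rewrite !memv_ker piM => /eqP->.
    by rewrite mul0r.
  rewrite sg //; last exact: gen_inv.
  rewrite mulfV // leigenspace1 memv_ker -(bos_G1 H) piG bos_G1 oner_eq0.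
  by move/(_ isT).
have [c pic] := pi_kG a.
move: aw; rewrite mem_leigenspace => /eqP ra.
have e : \sum_x (((alpha (bos_G H x))^-1 - w) * c x) *: bos_G H x = 0.
  transitivity (rho (pi a) - w *: pi a); last first.
    by rewrite -pi_rho ra linearZ subrr.
  rewrite pic linear_sum scaler_sumr -sumrB; apply: eq_bigr => x _.
  by rewrite linearZ /= rho_G !scalerA -scalerBl mulrBl mulrC.
have [x cx] : exists x, c x != 0.
  apply/existsP; apply: contraNT pia => /existsPn c0.
  rewrite memv_ker pic big1 // => x _.
  by move/negPn/eqP: (c0 x) => ->; rewrite scale0r.
exists (x^-1)%g; move/eqP: (bos_G_free e x).
rewrite mulf_eq0 (negPf cx) orbF subr_eq0 => /eqP <-.
by rewrite alphaVE.
Qed.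

End Nakayama.
End Bosonization.

(** * The equivalences *)

Theorem proposition3p1 (k : fieldType) (gT : finGroupType) (n : nat)
  (g : 'I_n -> gT) (chi : 'I_n -> gT -> k)
  (abelianG : abelian [set: gT])
  (chi_char : forall i, is_character (chi i))
  (R : nicholsAlgebra (braiding_matrix g chi))
  (H : bosonization R)
  (phi : 'Hom(H, k^o)) (phi_neq0 : phi != 0)
  (phi_int : dual_right_integral phi)
  (rho : 'AEnd(H)) (rho_nak : nakayama_automorphism phi rho)
  (t : H) (t_neq0 : t != 0) (t_int : right_integral t)
  (alpha : {lrmorphism H -> k^o}) (alpha_mod : modular_element t alpha) :
  is_grading (L1 alpha) (nakayama_component rho) /\
  [<-> strongly_graded (L1 alpha) (nakayama_component rho);
       (forall w, L1 alpha w <-> L2 alpha w);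
       (forall w, L1 alpha w -> exists x, bos_G H x \in nakayama_component rho w);
       crossed_product (L1 alpha) (nakayama_component rho)].
Proof.
have grH := nakayama_grading chi_char phi_neq0 phi_int rho_nak t_neq0 t_int
  alpha_mod.
split=> //; tfae.
- move=> sg w; split; last exact: L2_L1.
  by apply: (strongly_graded_L2 chi_char phi_neq0 phi_int rho_nak t_neq0 t_int).
- move=> e w /e [x ->]; exists (x^-1)%g.
  have := rho_G_weight phi_neq0 phi_int rho_nak t_neq0 t_int alpha_mod (x^-1)%g.
  by rewrite invgK.
- move=> e w /e [x xw]; exists (bos_G H x) => //; exact: bos_G_unit.
- exact: crossed_strongly_graded.
Qed.
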